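(* There exist real numbers $\alpha$ and $\beta$, algebraically independent (over $\mathbb{Q}$), such that $$I_\alpha(t)-I_\beta(t)\to+\infty\quad\text{as } t\to+\infty.$$
   Context: For a real irrational number $\alpha$ and real $t\ge 1$ put $\psi_\alpha(t)=\min_{1\le q\le t}\|q\alpha\|$, where $q$ runs over integers and $\|\cdot\|$ denotes the distance to the nearest integer, and $I_\alpha(t)=\int_1^t\psi_\alpha(\xi)\,d\xi$. *)

(* Defs.v *)
From HB Require Import structures.
From mathcomp Require Import all_boot all_order all_algebra.
From mathcomp Require Import all_classical all_reals all_analysis.
(* The notations of mpoly conflict with those of mathcomp-analysis. *)
From mathcomp Require Import -(notations) mpoly.

Set Implicit Arguments.
Unset Strict Implicit.
Unset Printing Implicit Defensive.

Import Order.TTheory GRing.Theory Num.Theory.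
Import numFieldNormedType.Exports.

Local Open Scope classical_set_scope.
Local Open Scope ring_scope.

(* [mpoly n rat] is the ring of polynomials in n variables over Q, and
   [mmap ratr x p] is the value p(x_0, ..., x_(n-1)), the coefficients
   being embedded in F by [ratr]. *)
Definition algebraically_independent (F : numFieldType) (n : nat)
    (x : 'I_n -> F) : Prop :=
  forall p : mpoly n rat, mmap ratr x p = 0 -> p = 0.

Lemma algebraically_independent_irrational (R : realType) n
    (x : 'I_n -> R) (i : 'I_n) :
  algebraically_independent x -> @irrational R (x i).
Proof.
move=> indep; rewrite irrationalE => q _ /= [_ -> qE].
have /indep/(congr1 (mcoeff (mnm1 i))) :
    mmap ratr x (mpolyX rat (mnm1 i) - mpolyC n q) = 0.
  by rewrite mmapB mmapC mmapX mmap1U -qE subrr.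
rewrite mcoeffB mcoeffX eqxx mcoeffC mnm1_eq0 mulr0 subr0 mcoeff0.
by move/eqP; rewrite oner_eq0.
Qed.

Section Approximation.
Variable R : realType.
Implicit Types (x a t : R).

Definition dist_int x : R := inf [set `|x - m%:~R| | m in [set: int]].

(* [psi] is total; only irrational [a] and 1 <= t are meaningful, and members
   of an algebraically independent family are irrational by
   [algebraically_independent_irrational].
   For 1 <= t the set is finite and nonempty, so that its infimum is a minimum,
   see [psi_min]. *)
Definition psi a t : R :=
  inf [set dist_int (q%:~R * a) | q in [set q : int | (1 <= q) && (q%:~R <= t)]].

Definition I_psi a t : R :=
  \int[lebesgue_measure]_(xi in `[1, t]) psi a xi.

Lemma inf_finite_in (A : set R) : finite_set A -> A !=set0 -> A (inf A).
Proof.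
move=> finA [y Ay].
have [s As] : exists s : seq R, A = [set` s] by apply/finite_seqP.
have [m sm lem] : exists2 m, m \in s & {in s, forall z, m <= z}.
  have : y \in s by move: Ay; rewrite As.
  clear; elim: s y => [//|z [|z' s] IH] y _.
    by exists z; rewrite ?mem_head// => w; rewrite inE => /eqP->.
  have [m ms lem] := IH z' (mem_head _ _).
  have [zm|mz] := leP z m.
    exists z; rewrite ?mem_head// => w; rewrite inE => /orP[/eqP->//|ws].
    exact: le_trans zm (lem _ ws).
  exists m; first by rewrite inE ms orbT.
  by move=> w; rewrite inE => /orP[/eqP->|/lem//]; exact: ltW.
suff -> : inf A = m by rewrite As.
apply/eqP; rewrite eq_le; apply/andP; split.
  by apply: ge_inf; [exists m => z; rewrite As; exact: lem | rewrite As].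
by apply: lb_le_inf; [exists y | move=> z; rewrite As; exact: lem].
Qed.

Lemma psi_min a t : 1 <= t ->
  (exists2 q : int, (1 <= q) && (q%:~R <= t) & psi a t = dist_int (q%:~R * a)) /\
  (forall q : int, (1 <= q) && (q%:~R <= t) -> psi a t <= dist_int (q%:~R * a)).
Proof.
move=> t1; pose B := [set q : int | (1 <= q) && (q%:~R <= t)].
have finB : finite_set B.
  apply: (@sub_finite_set _ _ (Posz @` `I_(Num.truncn t).+1)); last first.
    exact/finite_image/finite_II.
  move=> q /andP[q1 qt]; case: q q1 qt => n q1 qt.
    exists n => //=.
    by rewrite ltnS truncn_ge_nat// (le_trans ler01 t1).
  by [].
have inB : ((fun q : int => dist_int (q%:~R * a)) @` B)
    (inf ((fun q : int => dist_int (q%:~R * a)) @` B)).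
  apply: inf_finite_in; first exact: finite_image.
  by exists (dist_int (1%:~R * a)); exists 1 => //; rewrite /B /= lexx t1.
split; first by have [q Bq qE] := inB; exists q.
move=> q Bq; apply: ge_inf; last by exists q.
exists 0 => _ [r _ <-]; apply: lb_le_inf; first by exists `|r%:~R * a - 0%:~R|; exists 0.
by move=> _ [m _ <-].
Qed.

(* The distance to the nearest integer is also an attained minimum. *)
Lemma dist_intE x :
  dist_int x = Num.min (x - (Num.floor x)%:~R) ((Num.floor x + 1)%:~R - x).
Proof.
have fx : (Num.floor x)%:~R <= x by exact: floor_le.
have xf : x < (Num.floor x + 1)%:~R by exact: floorD1_gt.
apply/eqP; rewrite eq_le; apply/andP; split.
  have lb0 : has_lbound [set `|x - m%:~R| | m in [set: int]].
    by exists 0 => _ [m _ <-].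
  rewrite le_min; apply/andP; split; apply: ge_inf => //.
    by exists (Num.floor x) => //; rewrite ger0_norm ?subr_ge0.
  by exists (Num.floor x + 1) => //; rewrite distrC gtr0_norm ?subr_gt0.
apply: lb_le_inf; first by exists `|x - 0%:~R|; exists 0.
move=> _ [m _ <-]; rewrite ge_min; have [mf|fm] := leP m (Num.floor x).
  have mx : m%:~R <= (Num.floor x)%:~R :> R by rewrite ler_int.
  by rewrite [in X in X || _]ger0_norm ?subr_ge0 ?(le_trans mx fx)// lerB.
have mx : (Num.floor x + 1)%:~R <= m%:~R :> R by rewrite ler_int lezD1.
rewrite distrC ger0_norm ?subr_ge0 ?(le_trans (ltW xf) mx)//.
by rewrite [X in _ || X]lerB// orbT.
Qed.

End Approximation.

(* Main.v *)
Require Import Defs.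
From mathcomp Require Import all_boot all_order all_algebra.
From mathcomp Require Import all_classical all_reals all_analysis.
From mathcomp Require Import measurable_realfun.
From mathcomp Require Import zify ring lra.
From mathcomp Require Import -(notations) mpoly.

Import Order.TTheory GRing.Theory Num.Theory.
Import numFieldNormedType.Exports.

Set Implicit Arguments.
Unset Strict Implicit.
Unset Printing Implicit Defensive.

Local Open Scope classical_set_scope.
Local Open Scope ring_scope.

(** For every irrational [a] the integral [I_psi a] tends to infinity
    ([I_psi_dvg]), but for a suitable [b] of Liouville type it does so more
    slowly than any prescribed function. More precisely, given [f] tending to
    infinity and a countable set [C], [slow_I_psi] yields [b] outside [C] with
    [f - I_psi b] tending to infinity. Once this is known, take any
    transcendental [alpha], put [f := I_psi alpha], and let [C] be the set of
    reals that are algebraic over [Q(alpha)]: it is countable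
    ([countable_algebraically_dependent]), so [beta := b] is algebraically
    independent of [alpha]. The existence of [alpha] is the same argument over
    the empty family.

    The number [b] is the limit of fractions [p k / Q k] with
    [Q k.+1 = m k * Q k], such that the distance from [Q k * b] to the nearest
    integer is at most [3 / m k] ([avoid_sequence_approx]). On the range
    [Q k <= t <= Q k.+1] this gives
    [I_psi b t <= I_psi b (Q k) + 3 * t / m k], and in particular
    [I_psi b (Q k.+1) <= 4 * Q k], whatever the value of [m k]. Hence it is
    enough to choose [m k], knowing [Q k], so large that
    [f t >= 10 * Q k + k] for [t >= m k]. A choice between two digits at every
    step makes [b] avoid the k-th element of [C].

    The divergence of [I_psi a] comes from the inequality
    [1 <= 2 * q' * dist_int (q * a)] for [q'] the first integer that improves
    on [q] ([dist_int_consecutive]): between [T] and the first [q'] that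
    improves on all denominators up to [2 * T], the integral grows by at least
    [1 / 4]. *)

(** * Adjoining an independent element *)

Definition mnm_init (n : nat) (m : multinom n.+1) : multinom n :=
  Multinom [tuple m (widen_ord (leqnSn n) i) | i < n].

Lemma muni_mnmE (n : nat) (S : ringType) (p : mpoly n.+1 S) :
  muni p = \sum_(m <- msupp p)
     (mpolyC n (mcoeff m p) * mpolyX S (mnm_init m)) *: 'X^(m ord_max).
Proof.
rewrite muniE; apply: eq_bigr => m _; rewrite -mul_mpolyC; congr ((_ * mpolyX _ _) *: _).
Qed.

Lemma mnm_init_inj (n : nat) (m m' : multinom n.+1) :
  mnm_init m = mnm_init m' -> m ord_max = m' ord_max -> m = m'.
Proof.
move=> /mnmP mm' mx; apply/mnmP => i.
have [j ->|->] := unliftP ord_max i; last exact: mx.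
have -> : lift ord_max j = widen_ord (leqnSn n) j.
  by apply: val_inj; exact: lift_max.
by have := mm' j; rewrite !mnmE.
Qed.


(** Each coefficient of [p] is a coefficient of a coefficient of [muni p]. *)
Lemma muni_eq0 (n : nat) (S : ringType) (p : mpoly n.+1 S) : muni p = 0 -> p = 0.
Proof.
move=> p0; apply/mpolyP => m; rewrite mcoeff0.
have := congr1 (fun q : {poly mpoly n S} => mcoeff (mnm_init m) q`_(m ord_max)) p0.
rewrite coef0 mcoeff0 => <-; rewrite muni_mnmE coef_sum raddf_sum /=.
rewrite {1}[p]mpolyE raddf_sum /=; apply: eq_bigr => m' _.
rewrite mcoeffZ mcoeffX coefZ coefXn.
have [->|mm'] := eqVneq m' m.
  by rewrite eqxx !mulr1 mcoeffCM mcoeffX eqxx mulr1.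
have [mx|] := eqVneq (m ord_max) (m' ord_max); last by rewrite !mulr0 mcoeff0.
rewrite mulr1 mcoeffCM mcoeffX; case: eqP => [|//] /mnm_init_inj/(_ (esym mx))/eqP.
by rewrite (negPf mm').
Qed.

Lemma mmap_muni (F : numFieldType) (n : nat) (x : n.-tuple F) (b : F)
    (p : mpoly n.+1 rat) :
  mmap ratr (tnth (rcons_tuple x b)) p =
  (map_poly (mmap ratr (tnth x)) (muni p)).[b].
Proof.
rewrite muni_mnmE rmorph_sum horner_sum; apply: eq_bigr => m _ /=.
rewrite map_polyZ /= map_polyXn hornerZ hornerXn rmorphM /= mmapC mmapX -[RHS]mulrA; congr (_ * _).
rewrite /mmap1 big_ord_recr /=; congr (_ * _).
  apply: eq_bigr => i _; rewrite mnmE; congr (_ ^+ _).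
  by rewrite !(tnth_nth 0) /= nth_rcons size_tuple ltn_ord.
by rewrite (tnth_nth 0) /= nth_rcons size_tuple ltnn eqxx.
Qed.

Lemma countable_mpoly (n : nat) : countable [set: mpoly n rat].
Proof.
pose code (p : mpoly n rat) := [seq (m, mcoeff m p) | m <- msupp p].
have code_inj : injective code.
  have codeE p : p = \sum_(c <- code p) c.2 *: mpolyX rat c.1.
    by rewrite big_map {1}[p]mpolyE.
  by move=> p q pq; rewrite (codeE p) pq -codeE.
apply/countable_injP; exists (pickle \o code) => p q _ _.
by move=> /(pcan_inj pickleK)/code_inj.
Qed.

Lemma finite_poly_roots (F : fieldType) (p : {poly F}) :
  p != 0 -> finite_set [set b | root p b].
Proof.
move: {2}(size p) (leqnn (size p)) => n; elim: n p => [|n IHn] p.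
  by rewrite size_poly_leq0 => ->.
move=> pn p0; have [[b pb]|nop] := pselect (exists b, root p b); last first.
  by rewrite (_ : [set _ | _] = set0)//; apply/seteqP; split=> // b pb; case: nop; exists b.
have [q pE] := factor_theorem p b pb.
have q0 : q != 0 by apply: contra_neq p0 => q0; rewrite pE q0 mul0r.
apply: (@sub_finite_set _ _ ([set c | root q c] `|` [set b])); last first.
  rewrite finite_setU; split; last exact: finite_set1.
  by apply: IHn => //; move: pn; rewrite pE size_Mmonic ?monicXsubC// size_XsubC addn2.
by move=> c /=; rewrite pE rootM root_XsubC => /orP[|/eqP]; [left|right].
Qed.

(** A nonzero [p] becomes a nonzero univariate polynomial when its first [n]
    variables are set to the independent family [x]; it excludes only the
    finitely many roots of that polynomial, and there are countably many [p]. *)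
Lemma countable_algebraically_dependent (F : numFieldType) (n : nat) (x : n.-tuple F) :
  algebraically_independent (tnth x) ->
  countable [set b | ~ algebraically_independent (tnth (rcons_tuple x b))].
Proof.
move=> indep.
pose roots (p : mpoly n.+1 rat) :=
  [set b | root (map_poly (mmap ratr (tnth x)) (muni p)) b].
apply: (@sub_countable _ _ _ (\bigcup_(p in [set p | p != 0]) roots p)).
  apply: subset_card_le => b /existsNP[p /not_implyP[pb /eqP p0]].
  by exists p => //=; rewrite /roots /= /root -mmap_muni pb.
apply: bigcup_countable => [|p /= p0].
  exact: sub_countable (subset_card_le (@subsetT _ _)) (countable_mpoly _).
apply: finite_set_countable.
rewrite /roots; set P := map_poly _ _.
have P0 : P != 0.
  apply: contra_neq p0 => P0; apply/muni_eq0/polyP => k; rewrite coef0.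
  by apply: indep; rewrite -coef_map -/P P0 coef0.
exact: finite_poly_roots.
Qed.

Lemma algebraically_independent_nil (F : numFieldType) :
  algebraically_independent (tnth [tuple of [::] : seq F]).
Proof.
move=> p.
have -> : p = mpolyC 0 (mcoeff mnm0 p).
  apply/mpolyP => m; have -> : m = mnm0 by apply/mnmP => -[].
  by rewrite mcoeffC eqxx mulr1.
by rewrite mmapC => /eqP; rewrite fmorph_eq0 => /eqP ->; rewrite mpolyC0.
Qed.

(** * Monotonicity and growth of the integral *)

Section PsiIntegral.
Variable R : realType.
Implicit Types (x a s t : R).

Lemma dist_int_le x (m : int) : dist_int x <= `|x - m%:~R|.
Proof. by apply: ge_inf; [exists 0 => _ [k _ <-] | exists m]. Qed.

Lemma dist_int_attained x : exists m : int, dist_int x = `|x - m%:~R|.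
Proof.
have fx : (Num.floor x)%:~R <= x by exact: floor_le.
have xf : x < (Num.floor x + 1)%:~R by exact: floorD1_gt.
rewrite dist_intE; case: leP => _; [exists (Num.floor x)|exists (Num.floor x + 1)].
  by rewrite ger0_norm ?subr_ge0.
by rewrite distrC gtr0_norm ?subr_gt0.
Qed.

Lemma dist_int_ge0 x : 0 <= dist_int x.
Proof. by have [m ->] := dist_int_attained x. Qed.

Lemma dist_int_le1 x : dist_int x <= 1.
Proof.
apply: le_trans (dist_int_le x (Num.floor x)) _.
have := floor_le x; have := floorD1_gt x; rewrite intrD => h1 h2.
by rewrite ger0_norm ?subr_ge0// lerBlDl ltW.
Qed.

Lemma psi_ge0 a t : 1 <= t -> 0 <= psi a t.
Proof. by move=> /(psi_min a)[[q _ ->] _]; exact: dist_int_ge0. Qed.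

Lemma psi_le1 a t : 1 <= t -> psi a t <= 1.
Proof. by move=> /(psi_min a)[[q _ ->] _]; exact: dist_int_le1. Qed.

Lemma psi_le a s t : 1 <= s -> s <= t -> psi a t <= psi a s.
Proof.
move=> s1 st; have [[q /andP[q1 qs] ->] _] := psi_min a s1.
apply: (psi_min a (le_trans s1 st)).2.
by rewrite q1 (le_trans qs).
Qed.

(** [psi a] is monotone only on [1, +oo[, so its measurability is deduced from
    that of its extension by a constant to the left of 1. *)
Lemma psi_integrable a (D : set R) t : measurable D -> D `<=` `[1, t] ->
  (@lebesgue_measure R).-integrable D (EFin \o psi a).
Proof.
move=> mD Dt; suff : (@lebesgue_measure R).-integrable `[1, t] (EFin \o psi a).
  by apply: integrableS.
apply: measurable_bounded_integrable => //=.
- by rewrite lebesgue_measure_itv /=; case: ifP => // _; rewrite -EFinD ltry.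
- apply: (@eq_measurable_fun _ _ _ _ _ (psi a \o Num.max 1)).
    by move=> u; rewrite inE /= in_itv /= => /andP[u1 _]; rewrite max_r.
  apply: nonincreasing_measurable => // u v uv /=.
  apply: psi_le; first by rewrite le_max lexx.
  by rewrite ge_max !le_max lexx uv orbT.
- exists 1; split=> // M M1 u /=; rewrite in_itv /= => /andP[u1 _].
  by rewrite ger0_norm ?psi_ge0// (le_trans (psi_le1 _ _))// ltW.
Qed.

Lemma I_psiB a s t : 1 <= s -> s <= t ->
  I_psi a t - I_psi a s = \int[lebesgue_measure]_(xi in `]s, t[) psi a xi.
Proof.
move=> s1 st; rewrite /I_psi Rintegral_itvB ?bnd_simp//; last first.
  exact: (@psi_integrable a _ t).
apply/esym/Rintegral_itv_bndo_bndc; apply: (@psi_integrable a _ t) => //.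
move=> u /=; rewrite !in_itv /= => /andP[su ut].
by rewrite (le_trans s1 (ltW su)) ltW.
Qed.

Lemma Rintegral_itv_cst (c s t : R) : s <= t ->
  \int[lebesgue_measure]_(_ in `]s, t[) c = c * (t - s).
Proof.
move=> st; rewrite Rintegral_cst//= lebesgue_measure_itv /= lte_fin.
by have [|ts] := ltP; rewrite //= (@le_anti _ _ s t) ?st// subrr.
Qed.

Lemma integrable_itv_cst (c s t : R) :
  (@lebesgue_measure R).-integrable `]s, t[ (EFin \o cst c).
Proof.
apply: measurable_bounded_integrable => //=.
- by rewrite lebesgue_measure_itv /=; case: ifP => // _; rewrite -EFinD ltry.
- by exists `|c|; split=> // M cM u _; exact: ltW.
Qed.

Lemma I_psiB_le a s t : 1 <= s -> s <= t ->
  I_psi a t - I_psi a s <= psi a s * (t - s).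
Proof.
move=> s1 st; rewrite I_psiB// -Rintegral_itv_cst//.
apply: le_Rintegral => //=.
- apply: (@psi_integrable a _ t) => // u /=; rewrite !in_itv /= => /andP[su ut].
  by rewrite (le_trans s1 (ltW su)) ltW.
- exact: integrable_itv_cst.
- by move=> u; rewrite in_itv /= => /andP[su _]; exact/psi_le/ltW.
Qed.

Lemma I_psiB_ge a s t c : 1 <= s -> s <= t ->
  (forall u, s <= u -> u < t -> c <= psi a u) ->
  c * (t - s) <= I_psi a t - I_psi a s.
Proof.
move=> s1 st cpsi; rewrite I_psiB// -Rintegral_itv_cst//.
apply: le_Rintegral => //=.
- exact: integrable_itv_cst.
- apply: (@psi_integrable a _ t) => // u /=; rewrite !in_itv /= => /andP[su ut].
  by rewrite (le_trans s1 (ltW su)) ltW.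
- by move=> u; rewrite in_itv /= => /andP[su ut]; apply: cpsi => //; exact: ltW.
Qed.

Lemma I_psi_le a s t : 1 <= s -> s <= t -> I_psi a s <= I_psi a t.
Proof.
move=> s1 st; rewrite -subr_ge0 -[X in X <= _](mul0r (t - s)).
by apply: I_psiB_ge => // u su _; apply: psi_ge0; exact: le_trans su.
Qed.

Lemma I_psi1 a : I_psi a 1 = 0.
Proof. by rewrite /I_psi set_itv1 Rintegral_set1. Qed.

Lemma I_psi_le_id a t : 1 <= t -> I_psi a t <= t.
Proof.
move=> t1; have := I_psiB_le a (lexx 1) t1; rewrite I_psi1 subr0 => /le_trans; apply.
have := psi_le1 a (lexx 1); have := psi_ge0 a (lexx 1); nra.
Qed.
End PsiIntegral.

(** * Divergence for irrational numbers *)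

Section Divergence.
Variable R : realType.
Implicit Types (a t T : R).

Lemma dist_int_irrational_gt0 a (q : int) : irrational a -> 1 <= q ->
  0 < dist_int (q%:~R * a).
Proof.
move=> a_irr q1; rewrite lt_neqAle dist_int_ge0 andbT.
apply/negP => /eqP/esym d0; have [m dm] := dist_int_attained (q%:~R * a).
have qm : q%:~R * a = m%:~R by apply/eqP; rewrite -subr_eq0 -normr_eq0 -dm d0.
have q0 : q%:~R != 0 :> R by rewrite intr_eq0 gt_eqF//; exact: lt_le_trans q1.
apply: a_irr; exists (m%:~R / q%:~R) => //.
by rewrite fmorph_div /= !ratr_int -qm mulrC mulKf.
Qed.

(** Let [p] and [p'] be the integers nearest to [q * a] and [q' * a]. The
    determinant [q' * p - q * p'] equals [q * (q' * a - p') - q' * (q * a - p)]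
    and is a nonzero integer: the two distances would be proportional to [q] and
    [q'] if it vanished, against the strict inequality. *)
Lemma dist_int_consecutive a (q q' : int) : 1 <= q -> q <= q' ->
  dist_int (q'%:~R * a) < dist_int (q%:~R * a) ->
  1 <= 2 * q'%:~R * dist_int (q%:~R * a).
Proof.
move=> q1 qq'.
have [p ->] := dist_int_attained (q%:~R * a).
have [p' ->] := dist_int_attained (q'%:~R * a).
set x := _ - p%:~R; set y := _ - p'%:~R => yx.
have q1R : 1 <= q%:~R :> R by rewrite (ler_int _ 1 q).
have qqR : q%:~R <= q'%:~R :> R by rewrite ler_int.
have y0 := normr_ge0 y.
have q0 : 0 <= q%:~R :> R by lra.
have q'0 : 0 <= q'%:~R :> R by lra.
have det : (q' * p - q * p')%:~R = q%:~R * y - q'%:~R * x :> R.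
  by rewrite intrB !intrM /x /y; ring.
have [D0|D0] := eqVneq (q' * p - q * p') 0.
  have xy : `|q%:~R * y| = `|q'%:~R * x|.
    by congr `|_|; apply/eqP; rewrite -subr_eq0 -det D0.
  move: xy; rewrite !normrM (ger0_norm q0) (ger0_norm q'0).
  have : q'%:~R * `|y| < q'%:~R * `|x| by rewrite ltr_pM2l//; lra.
  nra.
have : 1 <= `|(q' * p - q * p')%:~R| :> R.
  by rewrite -intr_norm (ler_int _ 1) -gtz0_ge1 normr_gt0.
rewrite det => /le_trans/(_ (ler_normB (q%:~R * y) (q'%:~R * x))).
rewrite !normrM (ger0_norm q0) (ger0_norm q'0).
nra.
Qed.

(** Let [q] be the best denominator up to [2 * T], at distance [d]. If [n] is the
    first denominator with a smaller distance, then [psi a >= d] on [T, n[, where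
    [d >= 1 / (2 * n)] and [n - T >= n / 2]. If there is no such [n], then
    [psi a >= d] on the whole half-line. *)
Lemma I_psi_step a T : irrational a -> 1 <= T ->
  exists2 t, T <= t & I_psi a T + 4^-1 <= I_psi a t.
Proof.
move=> a_irr T1; have T2 : 1 <= 2 * T by lra.
have [[q /andP[q1 qT] psiq] psi_min2T] := psi_min a T2.
set d := dist_int _ in psiq.
have d0 : 0 < d by exact: dist_int_irrational_gt0.
pose better n := (0 < n)%N && (dist_int ((n%:Z)%:~R * a) < d).
have [ex|nex] := pselect (exists n, better n); last first.
  have td : 0 <= d^-1 by rewrite invr_ge0 ltW.
  exists (T + d^-1); first lra.
  rewrite addrC -lerBrDr (@le_trans _ _ (d * (T + d^-1 - T)))//.
    by rewrite addrAC subrr add0r divff ?gt_eqF//; lra.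
  apply: I_psiB_ge => //; first lra.
  move=> u Tu _; have [[r /andP[r1 _] ->] _] := psi_min a (le_trans T1 Tu).
  rewrite leNgt; apply/negP => dr; case: nex; exists `|r|%N.
  have r0 : 0 < r by exact: lt_le_trans r1.
  by rewrite /better absz_gt0 gt_eqF// gtz0_abs.
case: (ex_minnP ex) => n /andP[n0 nd] n_min.
have n1 : 1 <= n%:Z by rewrite lez_nat.
have Tn : 2 * T < (n%:Z)%:~R.
  rewrite ltNge; apply/negP => nT.
  by have := psi_min2T n; rewrite n1 nT psiq leNgt nd => /(_ isT).
have qn : q <= n by rewrite -(ler_int R) (le_trans qT)// ltW.
have := dist_int_consecutive q1 qn nd; rewrite -/d => dn.
exists n%:Z%:~R; first lra.
rewrite addrC -lerBrDr (@le_trans _ _ (d * (n%:Z%:~R - T)))//; first nra.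
apply: I_psiB_ge => //; first lra.
move=> u Tu un; have [[r /andP[r1 ru] ->] _] := psi_min a (le_trans T1 Tu).
rewrite leNgt; apply/negP => dr.
have r0 : 0 < r by exact: lt_le_trans r1.
have : (n <= `|r|)%N.
  by apply: n_min; rewrite /better absz_gt0 gt_eqF// gtz0_abs.
rewrite -lez_nat gtz0_abs// => nr.
have : n%:Z%:~R <= r%:~R :> R by rewrite ler_int.
lra.
Qed.

Lemma I_psi_dvg a : irrational a -> I_psi a t @[t --> +oo] --> +oo.
Proof.
move=> a_irr.
have unbounded n : exists2 t : R, 1 <= t & n%:R / 4 <= I_psi a t.
  elim: n => [|n [t t1 nt]]; first by exists 1; rewrite // I_psi1 mul0r.
  have [u tu hu] := I_psi_step a_irr t1.
  exists u; first exact: le_trans tu.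
  by apply: le_trans hu; rewrite -natr1 mulrDl mul1r lerD.
apply/cvgryPge => A.
have [t t1 nt] := unbounded (Num.truncn (4 * A)).+1.
near=> u; apply: (@le_trans _ _ (I_psi a t)).
  apply: le_trans nt; have := truncnS_gt (4 * A); lra.
by apply: I_psi_le => //; near: u; exact: nbhs_pinfty_ge.
Unshelve. all: by end_near. Qed.
End Divergence.

(** * Numbers with a slowly growing integral *)

Section SlowGrowth.
Variable R : realType.
Implicit Types (f : R -> R) (C : set R) (t : R).

(** Nested intervals [lo k, hi k] of length [1 / Q k]: the next one is the
    subinterval of rank 0 or 2 among the [m k] equal parts of the current one.
    These two subintervals are disjoint, so one of them misses [c k]. Both lie
    within [3 / Q k.+1] of [lo k], whence the bound for [Q k * b]. *)
Lemma avoid_sequence_approx (c : nat -> R) (m Q : nat -> nat) :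
  (forall k, 3 <= m k)%N -> (0 < Q 0)%N -> (forall k, Q k.+1 = m k * Q k)%N ->
  exists b : R, (forall k, b != c k) /\
    (forall k, dist_int ((Q k)%:R * b) <= 3 / (m k)%:R).
Proof.
move=> m3 Q0 QS.
have Qgt0 k : (0 < Q k)%N by elim: k => // k IH; rewrite QS muln_gt0 IH (leq_trans _ (m3 k)).
pose digit k p := if c k <= (m k * p + 1)%:R / (Q k.+1)%:R then 2 else 0%N.
pose p := fix p k := if k is j.+1 then (m j * p j + digit j (p j))%N else 0%N.
pose lo k : R := (p k)%:R / (Q k)%:R.
pose hi k : R := (p k + 1)%:R / (Q k)%:R.
have le_frac x y k : (m k * x <= y)%N -> x%:R / (Q k)%:R <= y%:R / (Q k.+1)%:R :> R.
  move=> xy; rewrite ler_pdivrMr ?ltr0n// mulrAC ler_pdivlMr ?ltr0n//.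
  by rewrite -!natrM ler_nat QS; nia.
have ge_frac x y k : (y <= m k * x)%N -> y%:R / (Q k.+1)%:R <= x%:R / (Q k)%:R :> R.
  move=> xy; rewrite ler_pdivrMr ?ltr0n// mulrAC ler_pdivlMr ?ltr0n//.
  by rewrite -!natrM ler_nat QS; nia.
have lo_mono : {homo lo : i j / (i <= j)%N >-> i <= j}.
  apply: homo_leq => [x|y x z|k]; [exact: lexx|exact: le_trans|].
  by apply: le_frac; rewrite /= leq_addr.
have hi_mono : {homo hi : i j / (i <= j)%N >-> j <= i}.
  apply: homo_leq => [x|y x z xy yz|k]; [exact: lexx|exact: le_trans xy|].
  by apply: ge_frac; have := m3 k; rewrite /= /digit; case: ifP => _; lia.
have lo_hi i j : lo i <= hi j.
  apply: (@le_trans _ _ (lo (maxn i j))); first by apply: lo_mono; exact: leq_maxl.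
  apply: (@le_trans _ _ (hi (maxn i j))); last by apply: hi_mono; exact: leq_maxr.
  by rewrite ler_pM2r ?invr_gt0 ?ltr0n// ler_nat leq_addr.
pose b := sup (range lo).
have lo_b k : lo k <= b.
  by apply: ub_le_sup; [exists (hi 0) => _ [i _ <-]|exists k].
have b_hi k : b <= hi k.
  by apply: ge_sup; [exists (lo 0), 0 | move=> _ [i _ <-]].
exists b; split=> k.
  have := lo_b k.+1; have := b_hi k.+1.
  rewrite /lo /hi /= /digit; case: ifPn => [ck|].
    move=> _ lob; rewrite gt_eqF//; apply: (le_lt_trans ck); apply: lt_le_trans lob.
    by rewrite ltr_pM2r ?invr_gt0 ?ltr0n// ltr_nat ltn_add2l.
  by rewrite -ltNge => ck hib _; rewrite lt_eqF//; apply: le_lt_trans ck; move: hib; rewrite addn0.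
apply: le_trans (dist_int_le _ (p k)) _.
have Qk0 : 0 < (Q k)%:R :> R by rewrite ltr0n.
have mk0 : 0 < (m k)%:R :> R by rewrite ltr0n (leq_trans _ (m3 k)).
have -> : (Q k)%:R * b - (p k)%:~R = (Q k)%:R * (b - lo k).
  by rewrite /lo mulrBr mulrCA divff ?mulr1// gt_eqF.
rewrite ger0_norm; last by apply: mulr_ge0; [exact: ltW | rewrite subr_ge0].
apply: (@le_trans _ _ ((Q k)%:R * (hi k.+1 - lo k))).
  by rewrite ler_pM2l// lerB.
rewrite /hi /lo /= QS.
have -> : 3 / (m k)%:R = (Q k)%:R *
    ((m k * p k + 3)%:R / (m k * Q k)%:R - (p k)%:R / (Q k)%:R) :> R.
  by rewrite natrD !natrM; field; rewrite !gt_eqF.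
rewrite ler_pM2l// lerD2r ler_pM2r ?invr_gt0 ?ltr0n ?muln_gt0 ?Qgt0 ?(leq_trans _ (m3 k))//.
rewrite ler_nat /digit; case: ifP => _; lia.
Qed.


(** The multiplier [m k] is a threshold beyond which [f] exceeds
    [10 * Q k + k]. For [t] between [Q k.+1] and [Q k.+2], either
    [t <= m k.+1] and [I_psi b t <= 4 * Q k + 3], while [f t >= 10 * Q k + k]
    since [t >= m k]; or [t >= m k.+1] and [I_psi b t <= 4 * Q k.+1], while
    [f t >= 10 * Q k.+1 + k.+1]. *)
Lemma slow_I_psi f C : f t @[t --> +oo] --> +oo -> countable C ->
  exists2 b, ~ C b & f t - I_psi b t @[t --> +oo] --> +oo.
Proof.
move=> f_oo /countable_injP[num num_inj].
pose c n := xget 0 [set x | C x /\ num x = n].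
have cC x : C x -> c (num x) = x.
  move=> Cx; have [] : C (c (num x)) /\ num (c (num x)) = num x.
    by apply: (@xgetPex _ 0 [set y | C y /\ num y = num x]); exists x.
  by move=> Cc /num_inj; apply; apply/mem_set.
have thresholds (kq : nat * nat) : exists M, (3 <= M)%N /\
    forall t, M%:R <= t -> 10 * kq.2%:R + kq.1%:R <= f t.
  have /cvgryPge/(_ (10 * kq.2%:R + kq.1%:R))[N [_ fN]] := f_oo.
  exists (maxn 3 (Num.truncn N).+1); split; first exact: leq_maxl.
  move=> t Mt; apply: fN; apply: lt_le_trans (truncnS_gt N) _.
  by apply: le_trans Mt; rewrite ler_nat leq_maxr.
have [M MP] := choice thresholds.
pose Q := fix Q k := if k is j.+1 then (M (j, Q j) * Q j)%N else 1%N.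
pose m k := M (k, Q k).
have m3 k : (3 <= m k)%N := (MP (k, Q k)).1.
have f_ge k t : (m k)%:R <= t -> 10 * (Q k)%:R + k%:R <= f t := (MP (k, Q k)).2 t.
have QS k : Q k.+1 = (m k * Q k)%N by [].
have kQ k : (k < Q k)%N by elim: k => // k IH; rewrite QS; have := m3 k; nia.
have [b [bc bQ]] := avoid_sequence_approx c m3 (ltn0Sn 0 : (0 < Q 0)%N) QS.
exists b; first by move=> Cb; have := bc (num b); rewrite cC// eqxx.
have Q1 k : 1 <= (Q k)%:R :> R by rewrite (ler_nat _ 1) (leq_ltn_trans _ (kQ k)).
have m0 k : 0 < (m k)%:R :> R by rewrite ltr0n (leq_trans _ (m3 k)).
have QSR k : (Q k.+1)%:R = (m k)%:R * (Q k)%:R :> R by rewrite -natrM.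
have I_growth k t : (Q k)%:R <= t ->
    I_psi b t <= I_psi b (Q k)%:R + 3 * (t / (m k)%:R).
  move=> Qt; rewrite -lerBlDl; apply: le_trans (I_psiB_le b (Q1 k) Qt) _.
  have psiQ : psi b (Q k)%:R <= 3 / (m k)%:R.
    apply: le_trans (bQ k); apply: ((psi_min b (Q1 k)).2 (Q k)).
    by rewrite lexx andbT lez_nat (leq_ltn_trans _ (kQ k)).
  apply: (@le_trans _ _ (3 / (m k)%:R * (t - (Q k)%:R))).
    by rewrite ler_wpM2r ?subr_ge0.
  have -> : 3 * (t / (m k)%:R) = 3 / (m k)%:R * t by ring.
  by rewrite ler_wpM2l ?divr_ge0 ?ler0n// lerBlDr lerDl ler0n.
have I_Q k : I_psi b (Q k.+1)%:R <= 4 * (Q k)%:R.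
  have QQ : (Q k)%:R <= (Q k.+1)%:R :> R by rewrite ler_nat QS leq_pmull// (leq_trans _ (m3 k)).
  have := I_growth _ _ QQ; have := I_psi_le_id b (Q1 k).
  have -> : (Q k.+1)%:R / (m k)%:R = (Q k)%:R :> R by rewrite QSR mulrAC divff ?mul1r ?gt_eqF.
  lra.
have gap k t : (Q k.+1)%:R <= t -> t <= (Q k.+2)%:R -> k%:R <= f t - I_psi b t.
  move=> Qt tQ; have It := I_growth _ _ Qt.
  have [tm|/ltW mt] := leP t (m k.+1)%:R.
    have tm1 : t / (m k.+1)%:R <= 1 by rewrite ler_pdivrMr// mul1r.
    have := I_Q k; have := Q1 k.
    suff /f_ge : (m k)%:R <= t by lra.
    by apply: le_trans Qt; rewrite QSR ler_peMr// ltW.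
  have tQ1 : t / (m k.+1)%:R <= (Q k.+1)%:R by rewrite ler_pdivrMr// mulrC -QSR.
  have := f_ge _ _ mt; have := I_psi_le_id b (Q1 k.+1); have := Q1 k.+1.
  rewrite -natr1; lra.
apply/cvgryPge => A; near=> t.
(* The index of the range that contains [t] is the last [k] with [Q k <= t]. *)
have tA : (Q (Num.truncn A).+2)%:R <= t by near: t; exact: nbhs_pinfty_ge.
pose P k := (Q k)%:R <= t.
have exP : exists k, P k by exists (Num.truncn A).+2.
have P_bound k : P k -> (k <= Num.truncn t)%N.
  move=> Pk; rewrite truncn_ge_nat; last by apply: le_trans Pk; rewrite ler0n.
  by apply: le_trans Pk; rewrite ler_nat ltnW.
case: (ex_maxnP exP P_bound) => -[|k] Pk k_max; first by have := k_max _ tA.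
have Ak : (Num.truncn A < k)%N by have := k_max _ tA.
apply: (@le_trans _ _ k%:R).
  by apply: le_trans (ltW (truncnS_gt A)) _; rewrite ler_nat.
apply: gap => //; rewrite leNgt; apply/negP => /ltW /(k_max k.+2).
by rewrite ltnn.
Unshelve. all: by end_near. Qed.
End SlowGrowth.

(** * Conclusion *)

Lemma transcendental_exists (R : realType) :
  exists a : R, algebraically_independent (tnth [tuple a]).
Proof.
pose C := [set a : R |
  ~ algebraically_independent (tnth (rcons_tuple [tuple of [::]] a))].
have C_cnt : countable C.
  exact/countable_algebraically_dependent/algebraically_independent_nil.
have [a /contrapT a_indep _] := slow_I_psi (@cvg_id _ +oo) C_cnt.
by exists a; rewrite (_ : [tuple a] = rcons_tuple [tuple of [::]] a)//; exact: val_inj.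
Qed.

Theorem mainTheorem5 (R : realType) :
  exists alpha beta : R,
    algebraically_independent (tnth [tuple alpha; beta]) /\
    (I_psi alpha t - I_psi beta t @[t --> +oo] --> +oo).
Proof.
have [alpha alpha_indep] := transcendental_exists R.
have alpha_irr : irrational alpha.
  exact: (algebraically_independent_irrational (i := ord0) alpha_indep).
have [beta /contrapT beta_indep gap] := slow_I_psi (I_psi_dvg alpha_irr)
  (countable_algebraically_dependent alpha_indep).
exists alpha, beta; split=> //.
by rewrite (_ : [tuple alpha; beta] = rcons_tuple [tuple alpha] beta)//; exact: val_inj.
Qed.
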